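(* Let $E$ be a Jordan algebra over $k$, $A$ a Jordan subalgebra of $E$, $B$ a given $A$-complement of $E$, and $r: B \to A$ a deformation map of the associated canonical matched pair $(A, B, \triangleright, \triangleleft)$. (1) Let $f_{r}: B \to E = A \bowtie B$ be the $k$-linear map defined for all $x \in B$ by $f_{r}(x) = (r(x), x)$. Then $\widetilde{B} := \mathrm{Im}(f_{r})$ is an $A$-complement of $E$. (2) $B_{r} := B$, as a $k$-vector space, with the new multiplication defined for all $x, y \in B$ by $$x \cdot_{r} y := x y + x \triangleleft r(y) + y \triangleleft r(x)$$ is a Jordan algebra (called the $r$-deformation of $B$). Furthermore, $B_{r} \cong \widetilde{B}$ as Jordan algebras.
   Context: Throughout, $k$ is a field of characteristic $\neq 2$ and all vector spaces and (bi)linear maps are over $k$. A Jordan algebra is a vector space $A$ with a bilinear multiplication (written by juxtaposition) which is commutative, $ab=ba$, and satisfies the Jordan identity $(a^2 b)a = a^2(ba)$ for all $a,b\in A$ (no unit is required). Let $A$ be a Jordan subalgebra of a Jordan algebra $E$. An $A$-complement of $E$ is a Jordan subalgebra $B$ of $E$ with $E=A+B$ and $A\cap B=\{0\}$. The canonical matched pair $(A,B,\triangleright,\triangleleft)$ associated to an $A$-complement $B$ of $E$ consists of the bilinear maps $\triangleright : B\times A\to A$ and $\triangleleft : B\times A\to B$ determined by the unique decomposition in $E=A\oplus B$: $$ba = b\triangleright a + b\triangleleft a,\qquad b\triangleright a\in A,\ b\triangleleft a\in B,\qquad a\in A,\ b\in B.$$ The bicrossed product $A\bowtie B$ is the vector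 space $A\times B$ with multiplication $$(a, x) \circ (b, y) := \bigl( a b + x \triangleright b + y\triangleright a , \ x\triangleleft b + y\triangleleft a + x y \bigr)\qquad (a,b\in A,\ x,y\in B);$$ it is a Jordan algebra and is identified with $E$ via the isomorphism $(a,x)\mapsto a+x$, under which $A$ corresponds to $A\times\{0\}$ and $B$ to $\{0\}\times B$. A deformation map of $(A,B,\triangleright,\triangleleft)$ is a $k$-linear map $r:B\to A$ such that for all $x,y\in B$: $$r(x y) - r(x) r(y) = x \triangleright r(y) + y \triangleright r(x) - r\bigl( x \triangleleft r(y) + y \triangleleft r(x) \bigr).$$ *)

(* Defs.v *)
From HB Require Import structures.
From mathcomp Require Import all_boot all_algebra.
From mathcomp Require Import boolp classical_sets.

Set Implicit Arguments.
Unset Strict Implicit.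
Unset Printing Implicit Defensive.

Import GRing.Theory.
Local Open Scope ring_scope.
Local Open Scope classical_set_scope.

Definition jordan_axioms (k : fieldType) (V : lmodType k) (m : V -> V -> V) :=
  [/\ forall a, linear (m a),
      forall b, linear (fun a => m a b),
      forall a b, m a b = m b a
    & forall a b, m (m (m a a) b) a = m (m a a) (m b a)].

HB.mixin Record Lmodule_isJordan (k : fieldType) V of GRing.Lmodule k V := {
  jmul : V -> V -> V;
  jmulP : jordan_axioms jmul
}.

#[short(type="jordanAlgType")]
HB.structure Definition JordanAlgebra (k : fieldType) :=
  {V of Lmodule_isJordan k V & GRing.Lmodule k V}.

Reserved Notation "x ** y" (at level 40, left associativity).
Notation "x ** y" := (jmul x y) : ring_scope.

Section JordanTheory.
Context {k : fieldType} {V : jordanAlgType k}.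
Implicit Types (a b x y : V) (c : k).

Fact jmul_linearr a c x y : a ** (c *: x + y) = c *: (a ** x) + a ** y.
Proof. by have [lr _ _ _] := @jmulP k V; exact: lr. Qed.

Fact jmul_linearl b c x y : (c *: x + y) ** b = c *: (x ** b) + y ** b.
Proof. by have [_ ll _ _] := @jmulP k V; exact: ll. Qed.

Fact jmulDr a x y : a ** (x + y) = a ** x + a ** y.
Proof. by rewrite -[x]scale1r jmul_linearr !scale1r. Qed.

Fact jmulDl b x y : (x + y) ** b = x ** b + y ** b.
Proof. by rewrite -[x]scale1r jmul_linearl !scale1r. Qed.

Fact jmulC a b : a ** b = b ** a.
Proof. by have [_ _ C _] := @jmulP k V; exact: C. Qed.

Fact jmul_jordan a b : ((a ** a) ** b) ** a = (a ** a) ** (b ** a).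
Proof. by have [_ _ _ J] := @jmulP k V; exact: J. Qed.

End JordanTheory.

Definition jordan_iso (k : fieldType) (J1 J2 : jordanAlgType k) : Prop :=
  exists phi : {linear J1 -> J2},
    bijective phi /\ {morph phi : x y / x ** y}.

Section Subalgebras.
Context {k : fieldType} {E : jordanAlgType k}.

Definition jordan_subalgebra (S : set E) : Prop :=
  GRing.submod_closed [in S] /\ (forall x y, S x -> S y -> S (x ** y)).

Record jordanSubalg := JordanSubalg {
  subalg_set : set E;
  subalgP : jordan_subalgebra subalg_set
}.

Definition subalg_mem (S : jordanSubalg) : {pred E} := [in subalg_set S].

Fact subalg_mem_closed (S : jordanSubalg) :
  GRing.subsemimod_closed (subalg_mem S).
Proof.
case: (subalgP S) => [[S0 Slin] _]; split; [split => // u v Su Sv|move=> a u Su].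
  by rewrite -[u]scale1r; apply: Slin.
by rewrite -[_ *: _]addr0; apply: Slin.
Qed.

HB.instance Definition _ (S : jordanSubalg) :=
  GRing.isSubmodClosed.Build k E (subalg_mem S) (subalg_mem_closed S).

Record subalg_type (S : jordanSubalg) := SubalgElt {
  subalg_val : E;
  _ : subalg_val \in subalg_mem S
}.

HB.instance Definition _ (S : jordanSubalg) := [isSub for @subalg_val S].
HB.instance Definition _ (S : jordanSubalg) := [Choice of subalg_type S by <:].
HB.instance Definition _ (S : jordanSubalg) :=
  [SubChoice_isSubLmodule of subalg_type S by <:].

Fact subalg_mul_subproof (S : jordanSubalg) (x y : subalg_type S) :
  val x ** val y \in subalg_mem S.
Proof.
case: (subalgP S) => _ SM; apply/mem_set/SM; apply: set_mem; exact: valP.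
Qed.

Definition subalg_mul (S : jordanSubalg) (x y : subalg_type S) : subalg_type S :=
  Sub (val x ** val y) (subalg_mul_subproof x y).

Fact subalg_valM (S : jordanSubalg) (x y : subalg_type S) :
  val (subalg_mul x y) = val x ** val y.
Proof. exact: SubK. Qed.

Fact subalg_mulP (S : jordanSubalg) : jordan_axioms (@subalg_mul S).
Proof.
split.
- by move=> a c x y; apply: val_inj; rewrite !(linearP, subalg_valM) jmul_linearr.
- by move=> b c x y; apply: val_inj; rewrite !(linearP, subalg_valM) jmul_linearl.
- by move=> a b; apply: val_inj; rewrite !subalg_valM jmulC.
- by move=> a b; apply: val_inj; rewrite !subalg_valM jmul_jordan.
Qed.

HB.instance Definition _ (S : jordanSubalg) :=
  Lmodule_isJordan.Build k (subalg_type S) (@subalg_mulP S).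

Definition jordan_complement (A : jordanSubalg) (B : set E) : Prop :=
  [/\ jordan_subalgebra B,
      [set a + b | a in subalg_set A & b in B] = [set: E]
    & subalg_set A `&` B = [set 0]].

End Subalgebras.

Arguments jordanSubalg {k} E.
Coercion subalg_type : jordanSubalg >-> Sortclass.

Section MatchedPair.
Context {k : fieldType} {E : jordanAlgType k} {A B : jordanSubalg E}.
Hypothesis hAB : jordan_complement A (subalg_set B).

Fact complement_decomp (e : E) : {p : A * B | e = val p.1 + val p.2}.
Proof.
apply: cid; case: hAB => _ /seteqP[_ /(_ e I)] [a Aa [b Bb <-]] _.
by exists (Sub a (mem_set Aa), Sub b (mem_set Bb)).
Qed.

Definition complement_fst (e : E) : A := (sval (complement_decomp e)).1.
Definition complement_snd (e : E) : B := (sval (complement_decomp e)).2.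

Fact complement_decompE (e : E) :
  e = val (complement_fst e) + val (complement_snd e).
Proof. exact: svalP (complement_decomp e). Qed.

Fact complement_inj (a a' : A) (b b' : B) :
  val a + val b = val a' + val b' -> a = a' /\ b = b'.
Proof.
move=> eab; have d : val (a - a') = val (b' - b).
  rewrite !raddfB /=; apply/eqP.
  by rewrite subr_eq addrAC [_ + val a']addrC -eab addrK.
have Aa : subalg_set A (val (a - a')) by apply: set_mem; exact: valP.
have Ba : subalg_set B (val (a - a')) by rewrite d; apply: set_mem; exact: valP.
have z : val (a - a') = 0.
  by case: hAB => _ _ /seteqP[+ _] => /(_ _ (conj Aa Ba)).
have za : a - a' = 0 by apply: val_inj; rewrite z raddf0.
have zb : b' - b = 0 by apply: val_inj; rewrite -d z raddf0.
by split; apply/esym/eqP; rewrite ?(eq_sym a') -subr_eq0 ?za ?zb.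
Qed.

(* The canonical matched pair: lact b a is b ▷ a and ract b a is b ◁ a. *)
Definition lact (b : B) (a : A) : A := complement_fst (val b ** val a).
Definition ract (b : B) (a : A) : B := complement_snd (val b ** val a).

Fact lact_ractE (b : B) (a : A) :
  val b ** val a = val (lact b a) + val (ract b a).
Proof. exact: complement_decompE. Qed.

Definition bicrossed of jordan_complement A (subalg_set B) : Type := (A * B)%type.
Local Notation AB := (bicrossed hAB).

HB.instance Definition _ := GRing.Lmodule.on AB.

Definition bicrossed_mul (u v : AB) : AB :=
  (u.1 ** v.1 + lact u.2 v.1 + lact v.2 u.1,
   ract u.2 v.1 + ract v.2 u.1 + u.2 ** v.2).

(* The identification of the bicrossed product with E; see bicrossed_iso. *)
Definition bicrossed_val (u : AB) : E := val u.1 + val u.2.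

Fact bicrossed_val_linear : linear bicrossed_val.
Proof. by move=> c u v; rewrite /bicrossed_val !linearP /= scalerDr addrACA. Qed.

HB.instance Definition _ :=
  GRing.isLinear.Build k AB E *:%R bicrossed_val bicrossed_val_linear.

Fact bicrossed_val_bij : bijective bicrossed_val.
Proof.
exists (fun e => (complement_fst e, complement_snd e)) => [[a b]|e].
  have [<- <-] // := complement_inj (complement_decompE (bicrossed_val (a, b))).
by rewrite /bicrossed_val /= -complement_decompE.
Qed.

Fact bicrossed_val_mul : {morph bicrossed_val : u v / bicrossed_mul u v >-> u ** v}.
Proof.
have valD (S : jordanSubalg E) : {morph (val : S -> E) : u v / u + v} by [].
move=> [a x] [b y]; rewrite /bicrossed_val /bicrossed_mul.
rewrite [(a, x).1]/= [(a, x).2]/= [(b, y).1]/= [(b, y).2]/=.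
rewrite [_.1 in LHS]/fst [_.2 in LHS]/snd !valD jmulDr !jmulDl.
have -> : val (a ** b) = val a ** val b by [].
have -> : val (x ** y) = val x ** val y by [].
rewrite (jmulC (val a) (val y)) !lact_ractE -!addrA.
by congr (_ + (_ + _)); rewrite addrCA.
Qed.

Fact bicrossed_mulP : jordan_axioms bicrossed_mul.
Proof.
have vI := bij_inj bicrossed_val_bij; have vM := bicrossed_val_mul; split.
- by move=> a c x y; apply: vI; rewrite vM !linearP /= !vM jmul_linearr.
- by move=> b c x y; apply: vI; rewrite vM !linearP /= !vM jmul_linearl.
- by move=> a b; apply: vI; rewrite !vM jmulC.
- by move=> a b; apply: vI; rewrite !vM jmul_jordan.
Qed.

HB.instance Definition _ := Lmodule_isJordan.Build k AB bicrossed_mulP.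

Fact bicrossed_iso : jordan_iso AB E.
Proof.
by exists bicrossed_val; split; [exact: bicrossed_val_bij|exact: bicrossed_val_mul].
Qed.

Definition deformation_map (r : {linear B -> A}) : Prop :=
  forall x y : B,
    r (x ** y) - r x ** r y =
    lact x (r y) + lact y (r x) - r (ract x (r y) + ract y (r x)).

Section Deformation.
Variable r : {linear B -> A}.

Definition deformation_graph (x : B) : AB := (r x, x).

Fact deformation_graph_linear : linear deformation_graph.
Proof. by move=> c x y; rewrite /deformation_graph linearP. Qed.

HB.instance Definition _ :=
  GRing.isLinear.Build k B AB *:%R deformation_graph deformation_graph_linear.

Definition deformed_complement : set E :=
  bicrossed_val @` range deformation_graph.

Definition deformed_mul (x y : B) : B :=
  x ** y + ract x (r y) + ract y (r x).

(* B_r: the vector space B, with deformed_mul as its Jordan product. *)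
Definition deformed_alg of jordan_axioms deformed_mul : Type := B.

Variable hr : jordan_axioms deformed_mul.
HB.instance Definition _ := GRing.Lmodule.on (deformed_alg hr).
HB.instance Definition _ := Lmodule_isJordan.Build k (deformed_alg hr) hr.

End Deformation.
End MatchedPair.

(* Main.v *)
(* The map x |-> r x + x of B into E has the graph of r as its image; the deformation
   equation says precisely that it carries the deformed product to the product
   of E.  Being linear and injective, it transports the Jordan axioms of E back
   to the deformed product, and its image is closed under multiplication. *)
Require Import Defs.
From HB Require Import structures.
From mathcomp Require Import all_boot all_algebra.
From mathcomp Require Import boolp classical_sets.

Set Implicit Arguments.
Unset Strict Implicit.
Unset Printing Implicit Defensive.

Import GRing.Theory.
Local Open Scope ring_scope.
Local Open Scope classical_set_scope.

Section DeformationEmbedding.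
Context {k : fieldType} {E : jordanAlgType k} {A B : jordanSubalg E}.
Variables (hAB : jordan_complement A (subalg_set B)) (r : {linear B -> A}).

Definition deformation_embedding : B -> E :=
  bicrossed_val (hAB := hAB) \o deformation_graph hAB r.

HB.instance Definition _ := GRing.Linear.on deformation_embedding.

Lemma deformation_embeddingE x : deformation_embedding x = val (r x) + val x.
Proof. by []. Qed.

(** By uniqueness of the decomposition along [A] and [B], the [B]-component of [r x + x] is [x].
    This yields injectivity, and later the inverse of the isomorphism. *)
Lemma deformation_embeddingK :
  cancel deformation_embedding (complement_snd hAB).
Proof.
move=> x; have := complement_decompE hAB (deformation_embedding x).
by rewrite {1}deformation_embeddingE => /(complement_inj hAB)[_ <-].
Qed.

Lemma deformed_complementP e :
  deformed_complement hAB r e <-> exists x, e = deformation_embedding x.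
Proof.
split=> [[_ [x _ <-] <-]|[x ->]]; first by exists x.
by exists (deformation_graph hAB r x) => //; exists x.
Qed.

Lemma deformation_embedding_mem x :
  deformation_embedding x \in [in deformed_complement hAB r].
Proof. by apply/mem_set/deformed_complementP; exists x. Qed.

Hypothesis hr : deformation_map hAB r.

(** Compared in the bicrossed product, the [B]-components agree up to reordering, and the
    [A]-components agree by the deformation equation solved for [r (x ** y)]. *)
Lemma deformation_embeddingM :
  {morph deformation_embedding : x y / deformed_mul hAB r x y >-> x ** y}.
Proof.
move=> x y; rewrite /deformation_embedding /= -bicrossed_val_mul.
congr bicrossed_val; rewrite /bicrossed_mul /deformation_graph /deformed_mul /=.
congr pair; last by rewrite [RHS]addrC addrA.
have /eqP := hr x y; rewrite subr_eq => /eqP rxy.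
(* Grouping the two [ract] terms under one [r] produces exactly the term subtracted in [rxy], so the
   two cancel. *)
rewrite -addrA linearD rxy.
by rewrite addrAC subrK addrC addrA.
Qed.

Lemma deformed_mulP : jordan_axioms (deformed_mul hAB r).
Proof.
have gI := can_inj deformation_embeddingK.
have gM := deformation_embeddingM; split.
- by move=> a c x y; apply: gI; rewrite gM !linearP /= !gM jmul_linearr.
- by move=> b c x y; apply: gI; rewrite gM !linearP /= !gM jmul_linearl.
- by move=> a b; apply: gI; rewrite !gM jmulC.
- by move=> a b; apply: gI; rewrite !gM jmul_jordan.
Qed.

Lemma deformed_complement_subalgebra :
  jordan_subalgebra (deformed_complement hAB r).
Proof.
split; [split=> [|c u v]|move=> u v].
- by apply/mem_set/deformed_complementP; exists 0; rewrite linear0.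
- move=> /set_mem/deformed_complementP[x ->] /set_mem/deformed_complementP[y ->].
  by rewrite -linearP; exact: deformation_embedding_mem.
- move=> /deformed_complementP[x ->] /deformed_complementP[y ->].
  (* The preimage left open is found by unification: it is the deformed product of [x] and [y]. *)
  by apply/deformed_complementP; eexists; rewrite -deformation_embeddingM.
Qed.

Lemma deformed_complement_complement :
  jordan_complement A (deformed_complement hAB r).
Proof.
split; first exact: deformed_complement_subalgebra.
- rewrite -subTset => e _; rewrite (complement_decompE hAB e).
  set a := complement_fst hAB e; set x := complement_snd hAB e.
  (* Shift by [r x] within [A]: [a + x = (a - r x) + (r x + x)]. *)
  exists (val (a - r x)); first by apply: set_mem; exact: valP.
  exists (deformation_embedding x); first by apply/deformed_complementP; exists x.
  by rewrite deformation_embeddingE raddfB addrA subrK.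
- apply/seteqP; split=> [e [Ae /deformed_complementP[x ex]]|_ ->] /=.
    (* An element of the intersection decomposes both as [e + 0] and as [r x + x]; uniqueness forces
       [x = 0], hence [e = 0]. *)
    have : val (Sub e (mem_set Ae) : A) + val (0 : B) = val (r x) + val x.
      by rewrite raddf0 addr0 SubK ex.
    by move=> /(complement_inj hAB)[_ x0]; rewrite ex -x0 linear0.
  split; first by rewrite -(raddf0 (val : A -> E)); apply: set_mem; exact: valP.
  by apply/deformed_complementP; exists 0; rewrite linear0.
Qed.

(** The embedding corestricted to its image is the isomorphism, whichever proofs are used to form
    the two algebras. *)
Lemma deformed_alg_iso (Br_jordan : jordan_axioms (deformed_mul hAB r))
    (Bt_subalg : jordan_subalgebra (deformed_complement hAB r)) :
  jordan_iso (deformed_alg Br_jordan) (JordanSubalg Bt_subalg).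
Proof.
pose phi (x : deformed_alg Br_jordan) : JordanSubalg Bt_subalg :=
  SubalgElt (S := JordanSubalg Bt_subalg) (deformation_embedding_mem x).
have phi_linear : linear phi.
  move=> c x y; apply: val_inj; rewrite linearP.
  exact: (linearP deformation_embedding).
pose phiL := GRing.isLinear.Build _ _ _ _ phi phi_linear.
pose Phi : {linear deformed_alg Br_jordan -> JordanSubalg Bt_subalg} :=
  HB.pack phi phiL.
exists Phi; split.
  (* The inverse is the projection of [E] onto [B] along [A], restricted to the image. *)
  exists (fun u => complement_snd hAB (val u)) => [x|u].
    exact: deformation_embeddingK.
  have /set_mem/deformed_complementP[x ux] := valP u.
  by apply: val_inj => /=; rewrite ux deformation_embeddingK.
by move=> x y; apply: val_inj; exact: deformation_embeddingM.
Qed.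

End DeformationEmbedding.

Theorem theorem3p3 (k : fieldType) (hk : 2%N \notin [pchar k])
    (E : jordanAlgType k) (A B : jordanSubalg E)
    (hAB : jordan_complement A (subalg_set B))
    (r : {linear B -> A}) (hr : deformation_map hAB r) :
  jordan_complement A (deformed_complement hAB r) /\
  (exists (Br_jordan : jordan_axioms (deformed_mul hAB r))
          (Bt_subalg : jordan_subalgebra (deformed_complement hAB r)),
      jordan_iso (deformed_alg Br_jordan) (JordanSubalg Bt_subalg)).
Proof.
split; first exact: deformed_complement_complement.
exists (deformed_mulP hr), (deformed_complement_subalgebra hr).
exact: deformed_alg_iso.
Qed.
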